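(* Let $m$ be a positive integer, let $A\in\mathbb{R}^{m\times m}$ have spectral radius $\rho(A)<1$, and let $B\in\mathbb{R}^{m\times p}$. Assume that $f$ is invertible and that $f^{-1}$ and $h$ are continuous. Assume that $\mathcal{X}$ is backward stable, that is, $$\forall x\in\mathcal{X},\ \forall i\ge 1,\quad f^{-i}(x)\in\mathcal{X}.$$ Assume also that $\mathcal{X}$ is compact. Then there exists one and only one continuous function $T:\mathcal{X}\to\mathbb{R}^m$ that satisfies $$T(f(x))=A\,T(x)+B\,h(x)$$ for all $x\in\mathcal{X}$.
   Context: Let $n,p$ be positive integers, $f:\mathbb{R}^n\to\mathbb{R}^n$ and $h:\mathbb{R}^n\to\mathbb{R}^p$; they define the discrete-time system $x_{k+1}=f(x_k)$, $y_k=h(x_k)$. Let $\mathcal{X}_0\subset\mathcal{X}\subset\mathbb{R}^n$ be such that $f^k(x_0)\in\mathcal{X}$ for all $x_0\in\mathcal{X}_0$ and all integers $k\ge0$, where $f^k$ is the $k$-fold composition of $f$ with itself. For a positive integer $i$, $f^{-i}=(f^{-1})^i$ is the $i$-fold composition of $f^{-1}$ with itself.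
   Formalization: Since X is only backward stable, f(x) may lie outside X (e.g. f(x)=2x, X=[-1,1]), where T(f(x)) is undefined; the equation T(f(x))=AT(x)+Bh(x) is therefore required for those x in X with f(x) in X, which is all of X when f(X) is contained in X. *)

(* Defs.v *)
From HB Require Import structures.
From mathcomp Require Import all_boot all_order all_algebra.
From mathcomp Require Import all_classical all_reals all_analysis.
From mathcomp Require Import complex.
Set Implicit Arguments.
Unset Strict Implicit.
Unset Printing Implicit Defensive.
Import Order.TTheory GRing.Theory Num.Theory.
Import numFieldNormedType.Exports.
Local Open Scope classical_set_scope.
Local Open Scope ring_scope.

(* For 0 < m the set is finite and nonempty, so the supremum is a maximum;
   for m = 0 it is empty and the value is 0. *)
Definition spectral_radius (R : realType) (m : nat) (A : 'M[R]_m) : R :=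
  sup [set ComplexField.Normc.normc z | z in
        [set z : R[i] | eigenvalue (map_mx (real_complex R) A) z]].

Definition backward_stable (V : Type) (finv : V -> V) (X : set V) : Prop :=
  forall x, X x -> forall i : nat, (1 <= i)%N -> X (iter i finv x).

(* Main.v *)
Require Import Defs.
From HB Require Import structures.
From mathcomp Require Import all_boot all_order all_algebra.
From mathcomp Require Import all_classical all_reals all_analysis.
From mathcomp Require Import complex.
From mathcomp Require Import ring.
Set Implicit Arguments.
Unset Strict Implicit.
Unset Printing Implicit Defensive.
Import Order.TTheory GRing.Theory Num.Theory.
Import numFieldNormedType.Exports.
Local Open Scope classical_set_scope.
Local Open Scope ring_scope.

Import ComplexField.Normc.

(** Unfolding T(f(x)) = A T(x) + B h(x) along a backward orbit forces
    T(x) = sum_k A^k B h(f^-(k+1)(x)), the remainder after N steps being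
    A^N T(f^-N(x)).  Backward stability keeps the whole orbit inside X, so the
    map x |-> f^-1(x) restricts to a continuous self-map b of the compact
    space X, and with u(x) = B h(b(x)) the equation becomes
    T(x) = A T(b(x)) + u(x) on X.

    Everything then rests on the absolute summability of the powers of A, read
    off entrywise ([bounded_sums_entry_powers]).  Over the complex numbers,
    Cayley-Hamilton says that the sequence k |-> A^k is annihilated by the
    product of the operators (shift - z) over the eigenvalues z.  These
    operators can be stripped off one at a time: for |z| < 1, a sequence c is
    absolutely summable as soon as (shift - z) c is
    ([bounded_sums_recurrence]).  This avoids both the Jordan form and the
    formula for the spectral radius.

    Summability and the boundedness of u on the compact space give a uniformly
    convergent series of continuous functions ([weierstrass_M_test]), hence a
    continuous solution.  The difference D of two continuous solutions is
    bounded and satisfies D(x) = A^k D(b^k(x)) for every k, which tends to 0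
    ([skew_product_invariant_section]). *)

(** * Summability of the powers of a matrix of spectral radius below 1 *)

Lemma normc_ge0 (R : rcfType) (z : R[i]) : 0 <= normc z.
Proof. by case: z => x y; exact: sqrtr_ge0. Qed.

Lemma normc_real (R : rcfType) (x : R) : normc x%:C%C = `|x|.
Proof. by rewrite /= expr0n addr0 sqrtr_sqr. Qed.

(** A supremum bounds its set only if the set is bounded above.  Here the
    eigenvalues are among the finitely many roots of the characteristic
    polynomial, so the sum of the moduli of these roots is an upper bound. *)
Lemma normc_eigenvalue_lt1 (R : realType) (m : nat) (A : 'M[R]_m) (z : R[i]) :
  spectral_radius A < 1 ->
  eigenvalue (map_mx (real_complex R) A) z -> normc z < 1.
Proof.
move=> rhoA eig_z; apply: le_lt_trans rhoA.
apply: ub_le_sup; last by exists z.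
have [rs chi_rs] := closed_field_poly_normal
  (char_poly (map_mx (real_complex R) A)).
exists (\sum_(w <- rs) normc w) => _ [w eig_w <-].
have : w \in rs.
  move: eig_w => /=.
  rewrite eigenvalue_root_char chi_rs rootZ ?root_prod_XsubC//.
  by rewrite (monicP (char_poly_monic _)) oner_neq0.
move=> /(big_rem w) ->/=; rewrite lerDl sumr_ge0// => v _; exact: normc_ge0.
Qed.

(** If S is a partial sum of |c k|, the triangle inequality applied to
    c(k+1) = (c(k+1) - l c(k)) + l c(k) gives S <= |c 0| + V + |l| S, which can
    be solved for S because |l| < 1. *)
Lemma bounded_sums_recurrence (R : rcfType) (l : R[i]) (c : nat -> R[i])
    (V : R) :
  normc l < 1 ->
  (forall N, \sum_(k < N) normc (c k.+1 - l * c k) <= V) ->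
  forall N, \sum_(k < N) normc (c k) <= (normc (c 0%N) + V) / (1 - normc l).
Proof.
move=> l1 dV N; rewrite ler_pdivlMr ?subr_gt0// mulrBr mulr1 lerBlDr.
apply: (@le_trans _ _ (\sum_(k < N.+1) normc (c k))).
  by rewrite big_ord_recr/= lerDl normc_ge0.
rewrite big_ord_recl -addrA lerD2l.
apply: (@le_trans _ _ (\sum_(k < N)
    (normc (c k.+1 - l * c k) + normc l * normc (c k)))).
  apply: ler_sum => k _; rewrite -normcM.
  by rewrite -[X in normc X](subrK (l * c k)) le_normcD.
rewrite big_split/= -mulr_sumr mulrC lerD2r; exact: dV.
Qed.

(** The sequences k |-> (C^k q(C))_ij, for C the complexification of A and q a
    polynomial, vanish when q is the characteristic polynomial.  Removing the
    factors X - z from q one at a time preserves summability, and q = 1 is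
    the claim. *)
Lemma bounded_sums_entry_powers (R : realType) (m : nat) (A : 'M[R]_m.+1) :
  spectral_radius A < 1 ->
  forall i j, exists M : R, forall N, \sum_(k < N) `|(A ^+ k) i j| <= M.
Proof.
move=> rhoA i j.
set C := map_mx (real_complex R) A.
have [rs] := closed_field_poly_normal (char_poly C).
rewrite (monicP (char_poly_monic _)) scale1r => chi_rs.
have rs_lt1 z : z \in rs -> normc z < 1.
  move=> z_rs; apply: (normc_eigenvalue_lt1 rhoA).
  by rewrite eigenvalue_root_char chi_rs root_prod_XsubC.
(* C^k (X - z)(C) q(C) = C^(k+1) q(C) - z C^k q(C): the factor X - z acts as
   the operator (shift - z) on the sequence attached to q. *)
have peel ss q : (forall z, z \in ss -> normc z < 1) ->
    (exists V : R, forall N, \sum_(k < N) normc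
      ((C ^+ k * horner_mx C (q * \prod_(z <- ss) ('X - z%:P))) i j) <= V) ->
    exists V : R, forall N,
      \sum_(k < N) normc ((C ^+ k * horner_mx C q) i j) <= V.
  elim: ss q => [|z ss IH] q ss_lt1; first by rewrite big_nil mulr1.
  rewrite big_cons mulrA => /IH[|V dV].
    by move=> w w_ss; apply: ss_lt1; rewrite inE w_ss orbT.
  exists ((normc ((C ^+ 0 * horner_mx C q) i j) + V) / (1 - normc z)).
  apply: (bounded_sums_recurrence (c := fun k => (C ^+ k * horner_mx C q) i j)).
    exact/ss_lt1/mem_head.
  move=> N.
  apply: le_trans (dV N); apply: ler_sum => k _.
  rewrite le_eqVlt; apply/orP; left; apply/eqP; congr normc.
  rewrite [q * _]mulrC rmorphM/= rmorphB/= horner_mx_X horner_mx_C.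
  rewrite mulrA mulrBr mulrBl -exprSr -[_ * z%:M]/(_ *m z%:M) mul_mx_scalar.
  by rewrite -scalerAl !mxE.
have [|M boundM] := peel rs 1 rs_lt1.
  exists 0 => N; rewrite mul1r -chi_rs Cayley_Hamilton big1// => k _.
  by rewrite mulr0 mxE normc0.
exists M => N; apply: le_trans (boundM N); apply: ler_sum => k _.
by rewrite rmorph1 mulr1 -rmorphXn mxE normc_real.
Qed.

(** * Norm estimates and continuity for matrices *)

Lemma ler_entry_mx_norm (R : realType) (m n : nat) (M : 'M[R]_(m, n)) i j :
  `|M i j| <= `|M|.
Proof.
rewrite [leRHS]/Num.norm/= mx_normrE.
exact: (@le_bigmax _ _ _ 0 (fun ij => `|M ij.1 ij.2|) (i, j)).
Qed.

(** The sum of all the |A i j| is a crude operator bound for the maximum norm;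
    unlike the sharp one it needs no maximum over the rows, and sums of it over
    the powers of A reduce at once to the entries. *)
Lemma mx_norm_mulmx (R : realType) (m n : nat) (A : 'M[R]_(m, n))
    (v : 'cV[R]_n) :
  `|A *m v| <= (\sum_i \sum_j `|A i j|) * `|v|.
Proof.
have sum_ge0 i : 0 <= \sum_j `|A i j| by exact: sumr_ge0.
rewrite [leLHS]/Num.norm/= mx_normrE; apply/bigmax_leP; split=> [|[i l] _ /=].
  by rewrite mulr_ge0// sumr_ge0.
rewrite mxE; apply: le_trans (ler_norm_sum _ _ _) _.
rewrite (bigD1 i)//= mulrDl ler_wpDr//.
  by rewrite mulr_ge0// sumr_ge0.
rewrite mulr_suml; apply: ler_sum => j _.
by rewrite normrM ler_wpM2l// ler_entry_mx_norm.
Qed.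

Lemma mulmx_continuous (R : realType) (m n : nat) (A : 'M[R]_(m, n)) :
  continuous (fun v : 'cV[R]_n => A *m v).
Proof.
apply/(linear_bounded_continuous (mulmx A : {linear 'cV[R]_n -> 'cV[R]_m})).
apply/linear_boundedP; near=> r => v.
apply: le_trans (mx_norm_mulmx A v) _; apply: ler_wpM2r; first exact: normr_ge0.
by near: r; apply: nbhs_pinfty_ge; rewrite num_real.
Unshelve. all: by end_near. Qed.

(** Joins the complete and the normed structures of matrices, so that absolute
    convergence of a series of matrices yields its convergence. *)
HB.instance Definition _ (R : realType) (m n : nat) :=
  Complete.on 'M[R]_(m, n).

(** * Series of continuous functions *)

(** The tail of the majorant does not depend on g: this is what makes the
    convergence uniform when g runs over a family with a common majorant. *)
Lemma normed_series_tail (R : realType) (V : completeNormedModType R)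
    (g : V^nat) (a : R^nat) :
  (forall k, `|g k| <= a k) -> cvgn (series a) ->
  cvgn (series g) /\
  forall N, `|limn (series g) - series g N| <= limn (series a) - series a N.
Proof.
move=> g_le_a a_cvg.
have g_cvg : cvgn (series g).
  by apply: normed_cvg; apply: (series_le_cvg _ _ g_le_a a_cvg) => k //;
    exact: le_trans (g_le_a k).
split=> // N.
have a_nd : nondecreasing_seq (series a).
  by apply: nondecreasing_series => k _ _; exact: le_trans (g_le_a k).
have tail_cvg : (fun n => `|series g n - series g N|) @ \oo -->
    `|limn (series g) - series g N|.
  by apply: cvg_norm; apply: cvgB => //; exact: cvg_cst.
rewrite -(cvg_lim _ tail_cvg)//.
apply: limr_le; first by apply/cvg_ex; eexists; exact: tail_cvg.
near=> n.
have Nn : (N <= n)%N by near: n; exact: nbhs_infty_ge.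
apply: (@le_trans _ _ (series a n - series a N)); last first.
  by rewrite lerD2r; apply: nondecreasing_cvgn_le.
rewrite !sub_series Nn; apply: le_trans (ler_norm_sum _ _ _) _.
exact: ler_sum.
Unshelve. all: by end_near. Qed.

(** Three-epsilon argument: one partial sum, chosen from the majorant alone, is
    close to the whole series at every point, and it is continuous. *)
Lemma weierstrass_M_test (R : realType) (U : topologicalType)
    (V : completeNormedModType R) (g : nat -> U -> V) (a : R^nat) :
  (forall k, continuous (g k)) -> (forall k x, `|g k x| <= a k) ->
  cvgn (series a) ->
  continuous (fun x => limn (series (g ^~ x))).
Proof.
move=> g_cont g_le_a a_cvg.
have tail x := normed_series_tail (g_le_a ^~ x) a_cvg.
have partial_cont N : continuous (fun x => series (g ^~ x) N).
  elim: N => [|N IH].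
    rewrite (_ : (fun _ => _) = cst 0); first exact: cst_continuous.
    by apply/funext => x; rewrite /series/= big_geq.
  rewrite (_ : (fun _ => _) = (fun x => series (g ^~ x) N + g N x)).
    by move=> x; apply: cvgD; [exact: IH|exact: g_cont].
  by apply/funext => x; rewrite seriesSr.
move=> x; apply/cvgrPdist_lt => e e0.
have e30 : 0 < e / 3 by rewrite divr_gt0.
have [N aN] : exists N, limn (series a) - series a N < e / 3.
  have /cvgrPdist_lt/(_ _ e30)[N _ /(_ N (leqnn N))/= aN] := a_cvg.
  by exists N; apply: le_lt_trans aN; exact: ler_norm.
near=> y.
have xy : `|series (g ^~ x) N - series (g ^~ y) N| < e / 3.
  by near: y; move: (partial_cont N x) => /cvgrPdist_lt/(_ _ e30).
set Sx := limn (series (g ^~ x)); set Sy := limn (series (g ^~ y)).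
have tx : `|Sx - series (g ^~ x) N| < e / 3 := le_lt_trans ((tail x).2 N) aN.
have ty : `|Sy - series (g ^~ y) N| < e / 3 := le_lt_trans ((tail y).2 N) aN.
have -> : Sx - Sy = (Sx - series (g ^~ x) N) +
    (series (g ^~ x) N - series (g ^~ y) N) - (Sy - series (g ^~ y) N).
  by rewrite addrA subrK opprB addrA subrK.
apply: le_lt_trans (ler_normB _ _) _.
apply: le_lt_trans (lerD (ler_normD _ _) (lexx _)) _.
rewrite [e](_ : e = e / 3 + e / 3 + e / 3); last by field.
by rewrite !ltrD.
Unshelve. all: by end_near. Qed.
(** * Compact spaces *)

(** The identity of X, extended arbitrarily outside X, is continuous on the
    subspace X of T and maps it onto the subtype. *)
Lemma compact_set_type (T : topologicalType) (X : set T) :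
  compact X -> compact [set: X].
Proof.
move=> X_compact.
have [[x0 _]|X_empty] := pselect ([set: X] !=set0); last first.
  suff -> : [set: X] = set0 by exact: compact0.
  by apply/seteqP; split=> // x _; case: X_empty; exists x.
have -> : [set: X] = valL_ x0 (id : X -> X) @` X.
  apply/seteqP; split=> // x _; exists (\val x); first exact: set_valP.
  exact: (congr1 (@^~ x) (valLK x0 (id : X -> X))).
apply: continuous_compact => //; apply/subspace_valL_continuousP'.
by move=> x; exact: cvg_id.
Qed.

Lemma continuous_compact_bounded (R : realType) (U : topologicalType)
    (V : normedModType R) (D : U -> V) :
  compact [set: U] -> continuous D -> exists K : R, forall x, `|D x| <= K.
Proof.
move=> U_compact D_cont.
have [|M [_ D_le]] := @compact_bounded R V (range D).
  by apply: continuous_compact => //; exact: continuous_subspaceT.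
by exists (M + 1) => x; apply: D_le; [rewrite ltrDl|exists x].
Qed.

(** * The equation on a compact space *)

(** The graph of T is an invariant section of the skew product over b whose
    fibre maps are v |-> A v + u(x), a contraction for some norm of the fibre:
    T(x) = sum_k A^k u(b^k(x)) sums the inputs met along the b-orbit of x, and
    A^k D(b^k(x)) kills any bounded discrepancy D of two solutions. *)
Lemma skew_product_invariant_section (R : realType) (U : topologicalType)
    (m : nat) (A : 'M[R]_m) (b : U -> U) (u : U -> 'cV[R]_m) :
  (0 < m)%N -> spectral_radius A < 1 -> compact [set: U] ->
  continuous b -> continuous u ->
  exists! T : U -> 'cV[R]_m,
    continuous T /\ forall x, T x = A *m T (b x) + u x.
Proof.
case: m A u => // m A u _ rhoA U_compact b_cont u_cont.
pose c k := \sum_i \sum_j `|(A ^+ k) i j|.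
have c_ge0 k : 0 <= c k.
  by apply: sumr_ge0 => i _; exact: sumr_ge0.
have c_cvg : cvgn (series c).
  have /choice[M cM] (ij : 'I_m.+1 * 'I_m.+1) :=
    bounded_sums_entry_powers rhoA ij.1 ij.2.
  apply: nondecreasing_is_cvgn; first exact: nondecreasing_series.
  exists (\sum_i \sum_j M (i, j)) => _ [N _ <-].
  rewrite /series/= big_mkord exchange_big; apply: ler_sum => i _.
  rewrite exchange_big; apply: ler_sum => j _; exact: (cM (i, j) N).
have [K u_le] := continuous_compact_bounded U_compact u_cont.
pose g k x := A ^+ k *m u (iter k b x).
pose T x := limn (series (g ^~ x)).
have g_le k x : `|g k x| <= c k * K.
  apply: le_trans (mx_norm_mulmx _ _) _.
  exact: ler_wpM2l (c_ge0 k) _ _ (u_le _).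
have cK_cvg : cvgn (series (fun k => c k * K)).
  rewrite (_ : series _ = fun N => series c N * K); first exact: is_cvgMl.
  by apply/funext => N; rewrite /series/= mulr_suml.
have iter_cont k : continuous (iter k b).
  elim: k => [|k IH] x; first exact: cvg_id.
  exact: continuous_comp (IH x) (b_cont _).
have g_cont k : continuous (g k).
  move=> x; apply: (continuous_comp _ (@mulmx_continuous _ _ _ (A ^+ k) _)).
  exact: continuous_comp (iter_cont k x) (u_cont _).
have T_cont : continuous T by exact: weierstrass_M_test g_cont g_le cK_cvg.
have g_cvg x : cvgn (series (g ^~ x)).
  by have [] := normed_series_tail (g_le ^~ x) cK_cvg.
(* The term of index k + 1 at x is A times the term of index k at b x. *)
have T_eq x : T x = A *m T (b x) + u x.
  have shift N : series (g ^~ x) N.+1 = A *m series (g ^~ (b x)) N + u x.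
    rewrite /series/= big_nat_recl// addrC mulmx_sumr; congr (_ + _).
      by apply: eq_bigr => k _; rewrite /g iterSr exprS mulmxA.
    by rewrite /g expr0 mul1mx.
  apply: (@cvg_lim _ (@norm_hausdorff _ _)).
  rewrite -(cvg_shiftS (series (g ^~ x))).
  under eq_fun do rewrite shift.
  apply: cvgD; last exact: cvg_cst.
  exact: (continuous_cvg _ (@mulmx_continuous _ _ _ A _) (g_cvg (b x))).
exists T; split=> [//|S [S_cont S_eq]]; apply/funext => x.
pose D y := T y - S y.
have D_cont : continuous D.
  by move=> y; apply: cvgB; [exact: T_cont|exact: S_cont].
have [K' D_le] := continuous_compact_bounded U_compact D_cont.
have D_iter k y : D y = A ^+ k *m D (iter k b y).
  elim: k => [|k IH]; first by rewrite expr0 mul1mx.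
  rewrite [LHS]IH iterS exprSr -mulmxA; congr (_ *m _).
  by rewrite /D T_eq S_eq opprD addrACA subrr addr0 mulmxBr.
suff : `|D x| <= 0 by rewrite normr_le0 subr_eq0 => /eqP.
have cK'_cvg : c k * K' @[k --> \oo] --> (0 : R).
  rewrite -(mul0r K'); apply: cvgMl; exact: cvg_series_cvg_0.
rewrite -(cvg_lim _ cK'_cvg)//; apply: limr_ge.
  by apply/cvg_ex; exists 0.
apply: nearW => k; rewrite (D_iter k x).
apply: le_trans (mx_norm_mulmx _ _) _.
exact: ler_wpM2l (c_ge0 k) _ _ (D_le _).
Qed.

(** * The observer equation on a backward stable compact set *)

Theorem theorem4 (R : realType) (n p m : nat)
    (n_gt0 : (0 < n)%N) (p_gt0 : (0 < p)%N) (m_gt0 : (0 < m)%N)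
    (f : 'cV[R]_n -> 'cV[R]_n) (h : 'cV[R]_n -> 'cV[R]_p)
    (X0 X : set 'cV[R]_n)
    (X0_sub : X0 `<=` X)
    (X0_orbit : forall x0, X0 x0 -> forall k : nat, X (iter k f x0))
    (A : 'M[R]_m) (B : 'M[R]_(m, p))
    (rhoA : spectral_radius A < 1)
    (finv : 'cV[R]_n -> 'cV[R]_n)
    (finvK : cancel f finv) (fK : cancel finv f)
    (finv_cont : continuous finv) (h_cont : continuous h)
    (X_stable : backward_stable finv X)
    (X_compact : compact X) :
  exists! T : X -> 'cV[R]_m,
    continuous T /\
    (* X need not be forward invariant: the equation is required at every
       x in X whose image f x lies in X, the domain of T. *)
    forall x y : X, \val y = f (\val x) ->
      T y = A *m T x + B *m h (\val x).
Proof.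
have X_finv (x : X) : finv (\val x) \in X.
  by apply/mem_set; exact: (X_stable _ (set_valP x) 1%N).
pose b (x : X) : X := exist _ (finv (\val x)) (X_finv x).
pose u (x : X) : 'cV[R]_m := B *m h (\val (b x)).
have val_cont : continuous (\val : X -> 'cV[R]_n).
  exact: initial_continuous.
have b_cont : continuous b.
  apply: continuous_comp_initial => x.
  exact: continuous_comp (val_cont x) (finv_cont _).
have u_cont : continuous u.
  move=> x; apply: (continuous_comp _ (@mulmx_continuous _ _ _ B _)).
  exact: continuous_comp (continuous_comp (b_cont x) (val_cont _)) (h_cont _).
(* As y = f x means x = b y, the equation indexed by pairs (x, f x) is the
   equation indexed by y alone. *)
have eqE (T : X -> 'cV[R]_m) :
    (forall y, T y = A *m T (b y) + u y) <->
    (forall x y : X, \val y = f (\val x) -> T y = A *m T x + B *m h (\val x)).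
  split=> T_eq => [x y yfx|y]; last by apply: T_eq; rewrite /= fK.
  have <- : b y = x by apply/val_inj; rewrite /= yfx finvK.
  exact: T_eq.
have [T [[T_cont /eqE T_eq] T_uniq]] :=
  skew_product_invariant_section m_gt0 rhoA (compact_set_type X_compact)
    b_cont u_cont.
exists T; split=> // S [S_cont /eqE S_eq].
exact: T_uniq.
Qed.
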